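(* Let $(Q,* )$ and $(K,\triangleright)$ be quandles. Suppose $\{\alpha_x\mid x\in Q\}\subset \mathrm{Aut}(Q)$ is a biquandle structure on $Q$ defining a biquandle $X$, and $\{\beta_y\mid y\in K\}\subset \mathrm{Aut}(K)$ is a biquandle structure on $K$ defining a biquandle $Y$. Then a quandle homomorphism $f\colon Q\to K$ lifts to a biquandle homomorphism $\widetilde{f}\colon X\to Y$ (that is, the same underlying map $f$ is a biquandle homomorphism $X\to Y$) if and only if $f\circ\alpha_x=\beta_{f(x)}\circ f$ for every $x\in Q$.
   Context: A quandle is a set $Q$ with an operation $*$ such that $x*x=x$; each map $x\mapsto x*y$ is a bijection; and $(x*y)*z=(x*z)*(y*z)$. A quandle homomorphism is a map preserving the quandle operation; $\mathrm{Aut}(Q)$ is the group of quandle automorphisms. A biquandle is a set $X$ with two binary operations $\underline{\ast},\overline{\ast}$ such that: (i) $x\,\underline{\ast}\,x=x\,\overline{\ast}\,x$ for all $x$; (ii) for every $y$ the maps $x\mapsto x\,\underline{\ast}\,y$ and $x\mapsto x\,\overline{\ast}\,y$ are bijections of $X$, and $S(x,y)=(y\,\overline{\ast}\,x,\;x\,\underline{\ast}\,y)$ is a bijection of $X\times X$; (iii) for all $x,y,z$: $(x\underline{\ast}y)\underline{\ast}(z\underline{\ast}y)=(x\underline{\ast}z)\underline{\ast}(y\overline{\ast}z)$, $(x\underline{\ast}y)\overline{\ast}(z\underline{\ast}y)=(x\overline{\ast}z)\underline{\ast}(y\overline{\ast}z)$, $(x\overline{\ast}y)\overline{\ast}(z\overline{\ast}y)=(x\overline{\ast}z)\overline{\ast}(y\underline{\ast}z)$.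 A biquandle homomorphism is a map preserving both operations. A biquandle structure on a quandle $(Q,* )$ is a family of quandle automorphisms $\{\beta_y\mid y\in Q\}\subset\mathrm{Aut}(Q)$ such that (1) $\beta_{\beta_y(x*y)}\circ\beta_y=\beta_{\beta_x(y)}\circ\beta_x$ for all $x,y\in Q$, and (2) $y\mapsto\beta_y(y)$ is a bijection of $Q$. It defines a biquandle on the set $Q$ by $x\,\underline{\ast}\,y=\beta_y(x*y)$ and $x\,\overline{\ast}\,y=\beta_y(x)$ (known fact). *)

(* Defs.v *)
From mathcomp Require Import all_boot.
From mathcomp Require Import boolp.

Set Implicit Arguments.
Unset Strict Implicit.
Unset Printing Implicit Defensive.

Record quandle := Quandle {
  qsort :> Type;
  qop : qsort -> qsort -> qsort;
  qop_idem : forall x, qop x x = x;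
  qop_bij : forall y, bijective (fun x => qop x y);
  qop_distr : forall x y z,
    qop (qop x y) z = qop (qop x z) (qop y z)
}.

Definition is_quandle_hom (Q K : quandle) (f : Q -> K) : Prop :=
  forall x y, f (qop x y) = qop (f x) (f y).

Record quandle_aut (Q : quandle) := QuandleAut {
  aut_fun :> Q -> Q;
  aut_hom : is_quandle_hom aut_fun;
  aut_bij : bijective aut_fun
}.

(* [under x y] and [over x y] are the operations written with an underlined
   and an overlined star. *)
Record biquandle := Biquandle {
  bsort :> Type;
  under : bsort -> bsort -> bsort;
  over : bsort -> bsort -> bsort;
  bq_diag : forall x, under x x = over x x;
  bq_under_bij : forall y, bijective (fun x => under x y);
  bq_over_bij : forall y, bijective (fun x => over x y);
  bq_S_bij :
    bijective (fun p : bsort * bsort => (over p.2 p.1, under p.1 p.2));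
  bq_exch_uu : forall x y z,
    under (under x y) (under z y) = under (under x z) (over y z);
  bq_exch_uo : forall x y z,
    over (under x y) (under z y) = under (over x z) (over y z);
  bq_exch_oo : forall x y z,
    over (over x y) (over z y) = over (over x z) (under y z)
}.

Definition is_biquandle_hom (X Y : biquandle) (f : X -> Y) : Prop :=
  (forall x y, f (under x y) = under (f x) (f y)) /\
  (forall x y, f (over x y) = over (f x) (f y)).

Definition is_biquandle_structure (Q : quandle) (beta : Q -> quandle_aut Q) :
    Prop :=
  (forall x y, beta (beta y (qop x y)) \o beta y =1
               beta (beta x y) \o beta x) /\
  bijective (fun y => beta y y).

Section BiquandleOfStructure.

Variables (Q : quandle) (beta : Q -> quandle_aut Q).
Hypothesis betaP : is_biquandle_structure beta.

Let under_op (x y : Q) : Q := beta y (qop x y).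
Let over_op (x y : Q) : Q := beta y x.

Lemma structure_comp x y t :
  beta (beta y (qop x y)) (beta y t) = beta (beta x y) (beta x t).
Proof. exact: betaP.1. Qed.

Lemma structure_diag x : under_op x x = over_op x x.
Proof. by rewrite /under_op qop_idem. Qed.

Lemma structure_under_bij y : bijective (fun x => under_op x y).
Proof. exact: bij_comp (aut_bij (beta y)) (qop_bij y). Qed.

Lemma structure_over_bij y : bijective (fun x => over_op x y).
Proof. exact: aut_bij. Qed.

(* If (x, y) is sent to (a, b), then evaluating [structure_comp] at t = y
   gives beta_b (beta_y y) = beta_a a.  This determines y, and then x. *)
Lemma structure_S_bij :
  bijective (fun p : Q * Q => (over_op p.2 p.1, under_op p.1 p.2)).
Proof.
have [s sK Ks] := betaP.2.
have invP (F : Q -> Q -> Q) : (forall y, bijective (F y)) ->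
    exists G, forall y, cancel (F y) (G y) /\ cancel (G y) (F y).
  move=> Fbij.
  have inv y : {g | cancel (F y) g /\ cancel g (F y)}.
    by apply: cid; have [g ? ?] := Fbij y; exists g.
  by exists (fun y => sval (inv y)) => y; exact: (svalP (inv y)).
have [bi bP] := invP _ (fun y => aut_bij (beta y)).
have [u uP] := invP (fun y x => under_op x y) structure_under_bij.
pose y_of (p : Q * Q) := s (bi p.2 (beta p.1 p.1)).
exists (fun p => (u (y_of p) p.2, y_of p)) => [[x y]|[a b]] /=.
  have -> : y_of (over_op y x, under_op x y) = y.
    rewrite /y_of /= -[RHS]sK; congr s.
    by rewrite -structure_comp (bP _).1.
  by rewrite (uP y).1.
set y := y_of (a, b); set x := u y b.
have Exy : under_op x y = b by rewrite /x (uP y).2.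
rewrite Exy; congr pair; apply: (can_inj sK).
have := structure_comp x y y; rewrite -/(under_op x y) Exy => <-.
by rewrite /y /y_of [beta (s _) _]Ks /= (bP _).2.
Qed.

Lemma structure_exch_uu x y z :
  under_op (under_op x y) (under_op z y) =
  under_op (under_op x z) (over_op y z).
Proof.
by rewrite /under_op /over_op -!aut_hom structure_comp -qop_distr.
Qed.

Lemma structure_exch_uo x y z :
  over_op (under_op x y) (under_op z y) =
  under_op (over_op x z) (over_op y z).
Proof. by rewrite /under_op /over_op -aut_hom structure_comp. Qed.

Lemma structure_exch_oo x y z :
  over_op (over_op x y) (over_op z y) =
  over_op (over_op x z) (under_op y z).
Proof. by rewrite /under_op /over_op structure_comp. Qed.

Definition biquandle_of : biquandle :=
  @Biquandle Q (fun x y => beta y (qop x y)) (fun x y => beta y x)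
    structure_diag structure_under_bij structure_over_bij structure_S_bij
    structure_exch_uu structure_exch_uo structure_exch_oo.

End BiquandleOfStructure.

(* Main.v *)
Require Import Defs.
From mathcomp Require Import all_boot.

(** Since [over x y] is [alpha y x], the commutation relation evaluated pointwise is exactly
    preservation of [over]. Preservation of [under] then comes for free: [under] is the quandle
    operation followed by the same automorphism, and [f] respects both. *)

Theorem proposition5p3 (Q K : quandle)
    (alpha : Q -> quandle_aut Q) (alphaP : is_biquandle_structure alpha)
    (beta : K -> quandle_aut K) (betaP : is_biquandle_structure beta)
    (f : Q -> K) (f_hom : is_quandle_hom f) :
  is_biquandle_hom (X := biquandle_of alphaP) (Y := biquandle_of betaP) f <->
  (forall x : Q, f \o alpha x =1 beta (f x) \o f).
Proof.
split=> [[_ f_over] x y | f_comm]; first exact: f_over y x.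
split=> x y /=; last exact: f_comm y x.
(* Folding [qop (f x) (f y)] into [f (qop x y)] leaves the commutation relation for [alpha y] at the
   point [qop x y]. *)
by rewrite -f_hom; exact: f_comm y (qop x y).
Qed.
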